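(* Let $\mathcal{M}$ be a map and let $I\subseteq R=\{0,1,2\}$. Then $\mathcal{M}$ is $I$-pseudo-orientable if and only if $\mathcal{M}$ is $(R\setminus I)$-colorable.
   Context: Map. A map $\mathcal{M}$ is an embedding of a graph (or pseudograph) on a compact connected surface such that the components of the complement (faces) are open disks. Choose a center in each face and a midpoint in each edge, and join each face-center to each incidence with the surrounding vertices and edge-midpoints; this, together with the original edges, divides the surface into triangles called flags. Combinatorially, a map is a pair $(\Omega,[r_0,r_1,r_2])$ where $\Omega$ is the (finite, since the surface is compact) set of flags, $r_0,r_1,r_2$ are permutations of $\Omega$ (acting on the right), $r_0,r_1,r_2$ and $r_0r_2$ are fixed-point-free of order 2, $r_0r_2=r_2r_0$, and $C(\mathcal{M})=\langle r_0,r_1,r_2\rangle$ is transitive on $\Omega$. Vertices, edges and faces correspond to orbits of $\langle r_1,r_2\rangle$, $\langle r_0,r_2\rangle$, $\langle r_0,r_1\rangle$ respectively. Sub-edges. The sides of the triangular flags are called sub-edges: type 0 joins an edge-midpoint to a face-center, type 1 joins a face-center to a vertex, type 2 joins a vertex to an edge-midpoint. Each flag $f$ has one side of each type, and $f$ is glued to the flag $fr_i$ along their common side of type $i$; the surface is obtained from the triangles by these gluings. Coloring. For $I\subseteq R$, an $I$-coloring of $\mathcal{M}$ is a function $a:\Omega\to\mathbb{Z}_2$ such that for every flag $f$ and every $j\in R$, $a(fr_j)\ne a(f)$ if $j\in I$ and $a(fr_j)=a(f)$ if $j\notin I$. $\mathcal{M}$ is $I$-colorable if it has an $I$-coloring.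 The map $X(\mathcal{M},I)$. For nonempty $I\subseteq R$, $X(\mathcal{M},I)$ is the map on the same surface whose faces are the regions formed by conjoining flags that are connected by each $r_i$ with $i\notin I$ (so flags $f$ and $fr_i$ lie in the same region for $i\notin I$); its graph is the union of the sub-edges of types in $I$, which form the boundaries of the regions. (For instance $X(\mathcal{M},\{2\})=\mathcal{M}$.) Face pseudo-orientation. A map is face pseudo-orientable if one can assign a circular arrow (a direction of rotation) to each face so that at each edge the arrows of the two faces (possibly the same face twice) meeting along the edge flow along the edge in the same direction; equivalently, the edges can be directed so that the cycle of edges around each face is consistently directed. In $X(\mathcal{M},I)$ this condition is imposed along every sub-edge of type in $I$. $I$-pseudo-orientable. For nonempty $I\subseteq R$, $\mathcal{M}$ is $I$-pseudo-orientable if $X(\mathcal{M},I)$ is face pseudo-orientable. $\mathcal{M}$ is $\emptyset$-pseudo-orientable if it is orientable, i.e. if the surface on which it is embedded is orientable. *)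

(* Defs.v *)
From mathcomp Require Import all_boot all_order all_algebra all_fingroup.
From mathcomp Require Import cyclic.

Set Implicit Arguments.
Unset Strict Implicit.
Unset Printing Implicit Defensive.

Import GRing.Theory.
Local Open Scope ring_scope.

(* The index set R = {0,1,2} is 'I_3, seen as Z/3 for the numerals and [third].
   Permutations act on the right, as in MathComp: (s * t)%g f = t (s f). *)
Record surface_map := SurfaceMap {
  flag : finType;
  r_ : 'I_3 -> {perm flag};
  r_order2 : forall i, #[r_ i]%g = 2%N;
  r_fpfree : forall i f, r_ i f != f;
  r02_order2 : #[r_ 0%R * r_ 2%R]%g = 2%N;
  r02_fpfree : forall f, (r_ 0%R * r_ 2%R)%g f != f;
  r02_comm : commute (r_ 0) (r_ 2);
  r_trans : [transitive <<[set r_ i | i : 'I_3]>>%g, on [set: flag] | 'P]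
}.

Arguments r_ {s} _%_R.

(* Class of f under <r_j | j in J>: vertices, edges and faces are the classes for
   J = {1,2}, {0,2} and {0,1}. *)
Definition cell (M : surface_map) (J : {set 'I_3}) (f : flag M) : {set flag M} :=
  orbit 'P <<[set r_ j | j in J]>>%g f.

Definition face (M : surface_map) (f : flag M) : {set flag M} :=
  cell [set 0; 1] f.

Definition faces (M : surface_map) : {set {set flag M}} :=
  [set face f | f : flag M].

Definition colorable (M : surface_map) (I : {set 'I_3}) : Prop :=
  exists a : flag M -> 'Z_2, forall (f : flag M) (j : 'I_3),
    (j \in I -> a (r_ j f) <> a f) /\ (j \notin I -> a (r_ j f) = a f).

(* A flag f also encodes the traversal of its edge, along its face, from the
   vertex end of f to that of f r_0.  The next step of this walk around the face
   is the one encoded by f r_0 r_1.  The directed closed walks around a face F,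
   i.e. the two directions of rotation of F, are thus the orbits of r_0 r_1
   contained in F. *)
Definition circular_arrow (M : surface_map) (F c : {set flag M}) : Prop :=
  c \in porbits (r_ 0 * r_ 1%R)%g /\ c \subset F.

(* The flags f and f r_2 are on the two sides of an edge, at the same end of it,
   so they traverse this edge in the same direction. *)
Definition face_pseudo_orientable (M : surface_map) : Prop :=
  exists arrow : {set flag M} -> {set flag M},
    (forall F, F \in faces M -> circular_arrow F (arrow F)) /\
    (forall f : flag M,
       (f \in arrow (face f)) = (r_ 2 f \in arrow (face (r_ 2 f)))).

(* Orientability of the surface obtained by gluing the triangles f and f r_i along
   their sides of type i.  The corner opposite to the side of type i is labelled
   i: 0 for the vertex, 1 for the edge-midpoint, 2 for the face-center; gluing
   respects these labels.  An orientation of the triangle f is a cyclic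
   permutation o f of its three corners; two adjacent triangles are coherently
   oriented when they induce opposite directions on their common side. *)
Definition orientable (M : surface_map) : Prop :=
  exists o : flag M -> {perm 'I_3},
    (forall f, #[o f]%g = 3%N) /\
    (forall (f : flag M) (i j k : 'I_3), uniq [:: i; j; k] ->
       (o f j == k) = (o (r_ i f) k == j)).

(* The element of {0,1,2} other than i and e, when i != e.  For a side i and one
   of its ends e, it is both the other end of i and the other side at e. *)
Definition third (i e : 'I_3) : 'I_3 := - (i + e).

(* A flag of X(M,I) is a triple (f, i, e): a flag f of M, a side i of f with i in
   I, and an end e of this side that is a vertex of X(M,I).  All ends are, except
   the edge-midpoints (e = 1) when only one of the types 0 and 2 is in I: then
   the two sub-edges at the midpoint are joined into one edge, so that X(M,{2})
   is M itself and not M with subdivided edges. *)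
Definition Xvalid (M : surface_map) (I : {set 'I_3})
    (x : flag M * 'I_3 * 'I_3) : bool :=
  let: (f, i, e) := x in
  [&& i \in I, e != i & (e == 1) ==> (third i e \in I)].

(* To the other end of the edge, on the same side of it.  If the sub-edge i of f
   ends at an interior point of an edge, which continues with the sub-edge i of
   f r_e, e being the other side of f at the midpoint, go to the end of that. *)
Definition X0 (M : surface_map) (I : {set 'I_3}) (x : flag M * 'I_3 * 'I_3) :=
  let: (f, i, e) := x in
  if (third i e == 1) && (e \notin I) then (r_ e f, i, e)
  else (f, i, third i e).

(* Around the vertex e, within the region, to the next sub-edge of type in I. *)
Definition X1 (M : surface_map) (I : {set 'I_3}) (x : flag M * 'I_3 * 'I_3) :=
  let: (f, i, e) := x in
  if third i e \in I then (f, third i e, e) else (r_ (third i e) f, i, e).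

(* Across the sub-edge i. *)
Definition X2 (M : surface_map) (x : flag M * 'I_3 * 'I_3) :=
  let: (f, i, e) := x in (r_ i f, i, e).

Definition Xraw (M : surface_map) (I : {set 'I_3}) (k : 'I_3) :
    flag M * 'I_3 * 'I_3 -> flag M * 'I_3 * 'I_3 :=
  if k == 0 then X0 I else if k == 1 then X1 I else @X2 M.

Lemma I3P (i : 'I_3) : [\/ i = 0, i = 1 | i = 2].
Proof.
by case: i => [[|[|[|//]]] Hi]; [apply: Or31|apply: Or32|apply: Or33];
  apply/val_inj.
Qed.

Lemma thirdE : (third 0 1 = 2) * (third 1 0 = 2) * (third 0 2 = 1) *
  (third 2 0 = 1) * (third 1 2 = 0) * (third 2 1 = 0).
Proof. by do !split; apply/val_inj. Qed.

Section Generated.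
Variables (T : finType) (p : 'I_3 -> {perm T}) (J : {set 'I_3}).
Local Notation gorbit := (orbit 'P <<[set p j | j in J]>>%g).

Lemma gorbit_ind (P : T -> Prop) x :
  P x -> (forall y j, j \in J -> P y -> P (p j y)) ->
  forall y, y \in gorbit x -> P y.
Proof.
move=> Px PS y /orbitP[w /gen_prodgP[n [c cJ ->]] <-] /=.
rewrite /aperm; elim: n c cJ => [|n IHn] c cJ.
  by rewrite big_ord0 perm1.
rewrite big_ord_recr /= permM; have /imsetP[j jJ ->] := cJ ord_max.
by apply: PS jJ _; apply: IHn => i; apply: cJ.
Qed.

Lemma gorbit_step x y j : j \in J -> x \in gorbit y -> p j x \in gorbit y.
Proof.
move=> jJ xy; apply: orbit_trans xy; apply/orbitP.
by exists (p j) => //; apply/mem_gen/imset_f.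
Qed.
End Generated.

Section MapLemmas.
Variable M : surface_map.
Implicit Types (f g : flag M).

Lemma rK i : involutive (@r_ M i).
Proof.
move=> f; have := expg_order (@r_ M i).
by rewrite r_order2 expgS expg1 => /permP/(_ f); rewrite permM perm1.
Qed.

Lemma r02C f : r_ 0 (r_ 2 f) = r_ 2 (r_ 0 f).
Proof. by rewrite -!permM (r02_comm M). Qed.

Lemma r02_neq f : r_ 0 (r_ 2 f) != f.
Proof. by rewrite r02C -permM r02_fpfree. Qed.
End MapLemmas.

Section X.
Variables (M : surface_map) (I : {set 'I_3}).
Local Notation Xflag := {x : flag M * 'I_3 * 'I_3 | Xvalid I x}.
Local Notation XFlag v := (exist (fun x => is_true (Xvalid I x)) _ v).

Lemma Xraw_valid k (x : flag M * 'I_3 * 'I_3) :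
  Xvalid I x -> Xvalid I (Xraw I k x).
Proof.
case: x => [[f i] e]; rewrite /Xraw.
case E0: (0 \in I); case E1: (1 \in I); case E2: (2 \in I);
by case: (I3P k) => ->; case: (I3P i) => ->; case: (I3P e) => -> //=;
  rewrite ?(thirdE, E0, E1, E2) //= ?(thirdE, E0, E1, E2).
Qed.

Lemma Xraw_K k (x : flag M * 'I_3 * 'I_3) :
  Xvalid I x -> Xraw I k (Xraw I k x) = x.
Proof.
case: x => [[f i] e]; rewrite /Xraw.
case E0: (0 \in I); case E1: (1 \in I); case E2: (2 \in I);
by case: (I3P k) => ->; case: (I3P i) => ->; case: (I3P e) => -> //=;
  rewrite ?(thirdE, E0, E1, E2) //= ?(thirdE, E0, E1, E2, rK).
Qed.

Lemma Xraw_neq k (x : flag M * 'I_3 * 'I_3) : Xvalid I x -> Xraw I k x != x.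
Proof.
case: x => [[f i] e]; rewrite /Xraw.
case E0: (0 \in I); case E1: (1 \in I); case E2: (2 \in I);
by case: (I3P k) => ->; case: (I3P i) => ->; case: (I3P e) => -> //=;
  rewrite ?(thirdE, E0, E1, E2) //= !xpair_eqE /= ?andbF ?andbT ?r_fpfree.
Qed.

Lemma Xraw_02C (x : flag M * 'I_3 * 'I_3) :
  Xvalid I x -> Xraw I 0 (Xraw I 2 x) = Xraw I 2 (Xraw I 0 x).
Proof.
case: x => [[f i] e]; rewrite /Xraw.
case E0: (0 \in I); case E1: (1 \in I); case E2: (2 \in I);
by case: (I3P i) => ->; case: (I3P e) => -> //=;
  rewrite ?(thirdE, E0, E1, E2) //= ?(thirdE, E0, E1, E2, r02C).
Qed.

Lemma Xraw_02_neq (x : flag M * 'I_3 * 'I_3) :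
  Xvalid I x -> Xraw I 2 (Xraw I 0 x) != x.
Proof.
case: x => [[f i] e]; rewrite /Xraw.
case E0: (0 \in I); case E1: (1 \in I); case E2: (2 \in I);
by case: (I3P i) => ->; case: (I3P e) => -> //=;
  rewrite ?(thirdE, E0, E1, E2) //= !xpair_eqE /= ?andbF ?andbT -?r02C
    ?r02_neq // r02C.
Qed.

Definition Xfun (k : 'I_3) (x : Xflag) : Xflag := Sub _ (Xraw_valid k (valP x)).

Lemma Xfun_inv k : involutive (Xfun k).
Proof. by move=> x; apply/val_inj; rewrite /= Xraw_K ?(valP x). Qed.

Definition Xr (k : 'I_3) : {perm Xflag} := perm (inv_inj (Xfun_inv k)).

Lemma val_Xr k (x : Xflag) : val (Xr k x) = Xraw I k (val x).
Proof. by rewrite permE. Qed.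

Hypothesis I_neq0 : I != set0.

Lemma Xflag_inhab (f : flag M) : exists x : Xflag, (val x).1.1 = f.
Proof.
suff [i [e ie]] : exists i e, Xvalid I (f, i, e) by exists (Sub _ ie).
have /set0Pn[i iI] := I_neq0; exists i.
by case: (I3P i) iI => -> iI; [exists 2 | exists 0 | exists 0]; rewrite /= iI.
Qed.

Lemma flag_inhab : exists f : flag M, True.
Proof. by have /imsetP[f _ _] := r_trans M; exists f. Qed.

Lemma order2_gen (T : finType) (p : {perm T}) (x : T) :
  involutive p -> p x != x -> #[p]%g = 2%N.
Proof.
move=> pK px; apply: nt_prime_order => //.
  by apply/permP=> y; rewrite expgS expg1 permM perm1 pK.
by apply: contraNneq px => ->; rewrite perm1.
Qed.

Lemma Xr_inv k : involutive (Xr k).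
Proof. by move=> x; rewrite !permE Xfun_inv. Qed.

Lemma Xr_fpfree k x : Xr k x != x.
Proof. by rewrite -val_eqE val_Xr; apply: Xraw_neq (valP x). Qed.

Lemma Xr_order2 k : #[Xr k]%g = 2%N.
Proof.
have [f _] := flag_inhab; have [x _] := Xflag_inhab f.
exact: order2_gen (Xr_inv k) (Xr_fpfree k x).
Qed.

Lemma Xr02_comm : commute (Xr 0) (Xr 2).
Proof.
apply/permP=> x; rewrite !permM; apply/val_inj.
by rewrite !val_Xr Xraw_02C ?(valP x).
Qed.

Lemma Xr02_fpfree x : (Xr 0 * Xr 2)%g x != x.
Proof. by rewrite permM -val_eqE !val_Xr Xraw_02_neq ?(valP x). Qed.

Lemma Xr02_order2 : #[Xr 0 * Xr 2]%g = 2%N.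
Proof.
have [f _] := flag_inhab; have [x _] := Xflag_inhab f.
apply: order2_gen (Xr02_fpfree x) => y.
by rewrite {1}Xr02_comm !permM !Xr_inv.
Qed.

Lemma Xraw_word (f : flag M) (i e i' e' : 'I_3) :
  Xvalid I (f, i, e) -> Xvalid I (f, i', e') ->
  exists w : seq 'I_3, {subset w <= [set 0; 1]} /\
    foldl (fun x k => Xraw I k x) (f, i, e) w = (f, i', e').
Proof.
pose W : seq (seq 'I_3) := [:: [::]; [:: 0]; [:: 1]; [:: 0; 1]; [:: 1; 0];
  [:: 0; 1; 0]; [:: 1; 0; 1]].
move=> v v'.
suff [w wW E] : exists2 w, w \in W &
    foldl (fun x k => Xraw I k x) (f, i, e) w = (f, i', e').
  exists w; split=> // k kw.
  have /allP/(_ w wW)/allP/(_ k kw) : all (all (mem [set 0; 1 : 'I_3])) W.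
    by rewrite /= !inE.
  by [].
move: v v'; rewrite {}/W /Xvalid /Xraw.
case E0: (0 \in I); case E1: (1 \in I); case E2: (2 \in I);
case: (I3P i) => ->; case: (I3P e) => -> //=; rewrite ?(thirdE, E0, E1, E2) //=;
case: (I3P i') => ->; case: (I3P e') => -> //=; rewrite ?(thirdE, E0, E1, E2) //=;
move=> _ _;
first [ by exists [::]
      | by exists [:: 0] => //=; rewrite ?(thirdE, E0, E1, E2)
      | by exists [:: 1] => //=; rewrite ?(thirdE, E0, E1, E2)
      | by exists [:: 0; 1] => //=; do 2 rewrite ?(thirdE, E0, E1, E2) /=
      | by exists [:: 1; 0] => //=; do 2 rewrite ?(thirdE, E0, E1, E2) /=
      | by exists [:: 0; 1; 0] => //=; do 3 rewrite ?(thirdE, E0, E1, E2) /=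
      | by exists [:: 1; 0; 1] => //=; do 3 rewrite ?(thirdE, E0, E1, E2) /= ].
Qed.

Local Notation Xorbit J := (orbit 'P (generated [set Xr j | j in J])).

Lemma Xorbit_base (x y : Xflag) :
  (val x).1.1 = (val y).1.1 -> y \in Xorbit [set 0; 1] x.
Proof.
case: x y => [[[f i] e] v] [[[g i'] e'] v'] /= E; subst g.
have [w [w01 E]] := Xraw_word v v'.
set x : Xflag := XFlag v; have -> : XFlag v' = foldl (fun x k => Xr k x) x w.
  apply/val_inj; rewrite /= -E -[(f, i, e)]/(val x); move: x.
  by elim: (w) => [|k w' IH] x //=; rewrite -IH val_Xr.
move: x {E}; elim/last_ind: w w01 => [|w k IH] w01 x; first exact: orbit_refl.
rewrite foldl_rcons; apply: gorbit_step; first by apply: (w01 k); rewrite mem_rcons mem_head.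
by apply: IH => l lw; apply: w01; rewrite mem_rcons inE lw orbT.
Qed.

Lemma Xstep_notin (f : flag M) j : j \notin I -> exists x k,
  [/\ k \in [set 0; 1], (val (x : Xflag)).1.1 = f &
      (val (Xr k x)).1.1 = r_ j f].
Proof.
move=> jI.
suff [i [e [k [k01 v E]]]] : exists i e k, [/\ k \in [set 0; 1],
    Xvalid I (f, i, e) & (Xraw I k (f, i, e)).1.1 = r_ j f].
  by exists (XFlag v), k; split; rewrite ?val_Xr.
have I012 : [|| 0 \in I, 1 \in I | 2 \in I].
  have /set0Pn[i] := I_neq0.
  by case: (I3P i) => -> ->; rewrite ?orbT.
have in0 : 0 \in [set 0; 1 : 'I_3] by rewrite !inE.
have in1 : 1 \in [set 0; 1 : 'I_3] by rewrite !inE.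
move: I012 jI; rewrite /Xraw /Xvalid.
case E0: (0 \in I); case E1: (1 \in I); case E2: (2 \in I) => //= _;
case: (I3P j) => ->; rewrite ?(E0, E1, E2) //= => _;
first [ by exists 1, 2, 1; split; rewrite ?(thirdE, E0, E1, E2) //= ?(thirdE, E0, E1, E2)
      | by exists 2, 0, 0; split; rewrite ?(thirdE, E0, E1, E2) //= ?(thirdE, E0, E1, E2)
      | by exists 0, 2, 1; split; rewrite ?(thirdE, E0, E1, E2) //= ?(thirdE, E0, E1, E2)
      | by exists 2, 0, 1; split; rewrite ?(thirdE, E0, E1, E2) //= ?(thirdE, E0, E1, E2)
      | by exists 1, 0, 1; split; rewrite ?(thirdE, E0, E1, E2) //= ?(thirdE, E0, E1, E2)
      | by exists 0, 2, 0; split; rewrite ?(thirdE, E0, E1, E2) //= ?(thirdE, E0, E1, E2)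
      ].
Qed.

Lemma Xstep_in (f : flag M) j : j \in I -> exists x,
  (val (x : Xflag)).1.1 = f /\ (val (Xr 2 x)).1.1 = r_ j f.
Proof.
move=> jI; suff [e v] : exists e, Xvalid I (f, j, e).
  by exists (XFlag v); rewrite val_Xr.
by case: (I3P j) jI => -> iI; [exists 2 | exists 0 | exists 0]; rewrite /= iI.
Qed.

Lemma Xorbit_face (x y : Xflag) :
  (y \in Xorbit [set 0; 1] x) = ((val y).1.1 \in cell (~: I) (val x).1.1).
Proof.
apply/idP/idP.
  move: y; apply: gorbit_ind; first exact: orbit_refl.
  move=> y k k01 yx; rewrite val_Xr.
  move: yx; case: (val y) => [[f i] e] /= fx.
  move: k01; rewrite !inE => /orP[]/eqP-> /=.
    rewrite /Xraw /X0 /=; case: ifP => [/andP[_ eI]|_] //=.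
    by apply: gorbit_step => //; rewrite inE.
  rewrite /Xraw /X1 /=; case: ifPn => [_|eI] //=.
  by apply: gorbit_step => //; rewrite inE.
suff H : forall g, g \in cell (~: I) (val x).1.1 ->
    forall y : Xflag, (val y).1.1 = g -> y \in Xorbit [set 0; 1] x.
  by move=> yx; apply: H yx _ erefl.
apply: gorbit_ind => [z /esym|g j jI IH z' yg]; first exact: Xorbit_base.
have [|z [k [k01 zg zk]]] := @Xstep_notin g j; first by move: jI; rewrite inE.
apply: orbit_trans (gorbit_step k01 (IH z zg)).
by apply: Xorbit_base; rewrite zk yg.
Qed.

Lemma Xr_trans :
  [transitive <<[set Xr i | i : 'I_3]>>%g, on [set: Xflag] | 'P].
Proof.
have setTE (T : finType) (p : 'I_3 -> {perm T}) :
    [set p i | i : 'I_3] = [set p i | i in [set: 'I_3]].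
  by apply/setP=> q; apply/imsetP/imsetP => -[i _ ->]; exists i.
have [f0 _] := flag_inhab; have [x0 x0f] := Xflag_inhab f0.
apply/imsetP; exists x0 => //; apply/esym/setP=> y; rewrite inE setTE.
have sub x z : z \in Xorbit [set 0; 1] x -> z \in Xorbit [set: 'I_3] x.
  move: z; apply/subsetP; apply: imsetS; apply: genS; apply: imsetS.
  by apply/subsetP.
have : (val y).1.1 \in orbit 'P <<[set @r_ M j | j in [set: 'I_3]]>>%g f0.
  by rewrite -setTE (atransP (r_trans M)).
move: {2}(val y).1.1 (erefl (val y).1.1) => g yg; rewrite yg => gf.
move: g gf y yg; apply: gorbit_ind => [y yf|g j _ IH y yg].
  by apply/sub/Xorbit_base; rewrite x0f.
have [jI|jI] := boolP (j \in I).
  have [z [zg zj]] := Xstep_in g jI.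
  apply: orbit_trans (gorbit_step (j := 2) _ (IH z zg)) => //.
  by apply/sub/Xorbit_base; rewrite zj yg.
have [z [k [k01 zg zk]]] := Xstep_notin g jI.
apply: orbit_trans (gorbit_step (j := k) _ (IH z zg)) => //.
by apply/sub/Xorbit_base; rewrite zk yg.
Qed.

Definition X : surface_map :=
  SurfaceMap Xr_order2 Xr_fpfree Xr02_order2 Xr02_fpfree Xr02_comm Xr_trans.
End X.

(* The faces of X(M,I) are the regions of flags of M connected by the r_i with
   i notin I. *)
Lemma X_face (M : surface_map) (I : {set 'I_3}) (I_neq0 : I != set0)
    (x y : flag (X M I_neq0)) :
  (y \in face x) = ((val y).1.1 \in cell (~: I) (val x).1.1).
Proof. exact: Xorbit_face. Qed.

Lemma set2_neq0 : [set 2 : 'I_3] != set0.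
Proof. by apply/set0Pn; exists 2; rewrite inE. Qed.

Lemma X_set2 (M : surface_map) :
  exists phi : flag M -> flag (X M set2_neq0), bijective phi /\
    forall i f, phi (r_ i f) = r_ i (phi f).
Proof.
have v (f : flag M) : Xvalid [set 2] (f, 2, 0) by rewrite /= inE.
exists (fun f => exist (fun x => is_true (Xvalid [set 2] x)) _ (v f)); split.
  exists (fun x => (val x).1.1) => [//|[[[f i] e] w]]; apply/val_inj => /=.
  move: w => /=; rewrite !inE => /and3P[/eqP-> e2].
  by case: (I3P e) e2 => ->.
move=> i f; apply/val_inj; rewrite val_Xr /=.
by case: (I3P i) => ->; rewrite /Xraw /= ?thirdE ?inE.
Qed.

Definition pseudo_orientable (M : surface_map) (I : {set 'I_3}) : Prop :=
  (I = set0 -> orientable M) /\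
  (forall I_neq0 : I != set0, face_pseudo_orientable (X M I_neq0)).

(* Main.v *)
Require Import Defs.
From mathcomp Require Import all_boot.
From mathcomp Require Import all_order all_algebra all_fingroup.
From mathcomp Require Import cyclic.

(** Write [R = {0,1,2}].  The theorem follows from three equivalences.

    First, a map is face pseudo-orientable if and only if it is
    [{0,1}]-colorable ([face_pseudo_orientableP]).  As [r_0] and [r_1] are
    fixed-point-free involutions, every face consists of exactly two orbits of
    [r_0 r_1], exchanged by both [r_0] and [r_1] ([face_porbit]); choosing a
    direction of rotation of a face is thus the same as coloring its flags so
    that [r_0] and [r_1] change the color, and the arrows agree along the edges
    when [r_2] preserves the color.

    Secondly, for nonempty [I], the map [X(M,I)] is [{0,1}]-colorable if and
    only if [M] is [R \ I]-colorable ([X_colorable]).  The flags of [X(M,I)]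
    lying over a flag [f] of [M] are pairs of a side [i] of the triangle [f] and
    an end [e] of this side, and every such pair carries a sign [flag_sign],
    telling whether traversing [i] from [e] follows the cyclic order of the
    labels of the corners or the opposite one.  The moves [r_0], [r_1] of
    [X(M,I)] either stay over [f] and reverse the sign, or keep the sign and go
    over [f r_j] for some [j] not in [I] ([Xraw01_cases]); the move [r_2] keeps
    the sign and goes over [f r_i] with [i] in [I].  Hence a coloring [a] of [M]
    and a coloring [b] of [X(M,I)] determine each other by
    [b (f, i, e) = a f + flag_sign i e]; that [a] is well defined from [b] is
    [X_color_same_base].

    Finally, [M] is orientable if and only if it is [R]-colorable
    ([orientableP]): a triangle has two orientations, the two 3-cycles of its
    corners, and adjacent triangles are coherently oriented exactly when their
    3-cycles are different, because the gluing preserves the labels. *)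

Set Implicit Arguments.
Unset Strict Implicit.
Unset Printing Implicit Defensive.

Import GRing.Theory.
Local Open Scope ring_scope.

(** * Boolean colorings *)

Lemma colorableP (M : surface_map) (I : {set 'I_3}) :
  colorable M I <->
  exists a : flag M -> bool, forall f j, a (r_ j f) = a f (+) (j \in I).
Proof.
split=> [[a aP] | [a aP]].
  have Z2 (x y : 'Z_2) : x <> y -> (x == 0) = ~~ (y == 0).
    by case: x y => [[|[|//]] ?] [[|[|//]] ?] //= []; apply/val_inj.
  exists (fun f => a f == 0) => f j; have [in_I notin_I] := aP f j.
  have [/in_I/Z2-> | /notin_I->] := boolP (j \in I); last by rewrite addbF.
  by rewrite addbT.
exists (fun f => if a f then 1 else 0) => f j; rewrite aP.
by split=> [-> | /negPf->]; case: (a f).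
Qed.

(** * Face pseudo-orientations as colorings *)

Section Faces.
Variable M : surface_map.
Implicit Types f g : flag M.

Local Notation rot := (r_ 0 * @r_ M 1)%g.

Lemma face_refl f : f \in face f.
Proof. exact: orbit_refl. Qed.

Lemma face_step f g j : j \in [set 0; 1] -> f \in face g -> r_ j f \in face g.
Proof. exact: gorbit_step. Qed.

Lemma face_r f j : j \in [set 0; 1] -> face (r_ j f) = face f.
Proof.
by move=> j01; apply/orbit_eqP/face_step/face_refl.
Qed.

Lemma in01 : (0 \in [set 0; 1 : 'I_3]) * (1 \in [set 0; 1 : 'I_3]).
Proof. by rewrite !inE. Qed.

Lemma rotE f : rot f = r_ 1 (r_ 0 f).
Proof. by rewrite permM. Qed.

Lemma porbit_rot f g : (rot f \in porbit rot g) = (f \in porbit rot g).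
Proof. by rewrite -!eq_porbit_mem -(porbit_perm rot 1 f) expg1. Qed.

(** The two directions of rotation are disjoint: otherwise a reflection in the
    dihedral group generated by [r_0] and [r_1], hence [r_0] or [r_1], would
    fix a flag. *)
Lemma rot_iter_neq n f : iter n rot f != r_ 0 f.
Proof.
suff [H _] : (forall f, iter n rot f != r_ 0 f) /\
             (forall f, iter n.+1 rot f != r_ 0 f) by [].
elim: n => [|n [IHn IHSn]]; split=> {}f //=.
- by rewrite eq_sym r_fpfree.
- by rewrite rotE r_fpfree.
- exact: IHSn.
(* Moving one factor [r_0 r_1] to each side turns an equality
   [f (r_0 r_1)^(n+2) = f r_0] into [f' (r_0 r_1)^n = f' r_0], with
   [f' = f r_0 r_1]. *)
apply: contraNneq (IHn (rot f)) => E; apply/eqP.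
rewrite -iterSr iterS; apply: (can_inj (rK 0)); apply: (can_inj (rK 1)).
by rewrite -rotE E !rotE !rK.
Qed.

Lemma porbit_r0_neq f g : f \in porbit rot g -> r_ 0 f \notin porbit rot g.
Proof.
rewrite -eq_porbit_mem => /eqP<-; apply/negP => /porbitP[n E].
by have := rot_iter_neq n f; rewrite -permX -E eqxx.
Qed.

(** A face consists of exactly two orbits of [r_0 r_1], exchanged by [r_0]. *)
Lemma face_porbit f g :
  f \in face g -> (r_ 0 f \in porbit rot g) = (f \notin porbit rot g).
Proof.
move=> fg.
have : f \in porbit rot g \/ r_ 0 f \in porbit rot g.
  move: f fg; apply: gorbit_ind; first by left; apply: porbit_id.
  move=> f j; rewrite !inE => /orP[]/eqP-> [IH|IH].
  - by right; rewrite rK.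
  - by left.
  - by right; rewrite -porbit_rot rotE !rK.
  - by left; rewrite -[f](rK 0) -rotE porbit_rot.
case=> H; last by rewrite H -[f](rK 0) porbit_r0_neq.
by rewrite H (negPf (porbit_r0_neq H)).
Qed.

Lemma face_pseudo_orientableP :
  face_pseudo_orientable M <-> colorable M [set 0; 1].
Proof.
split=> [[arrow [arrowP coherent]] | /colorableP[a aP]].
  apply/colorableP; exists (fun f => f \in arrow (face f)) => f j.
  have /arrowP[/imsetP[g _ +] /subsetP sub] : face f \in faces M.
    exact: imset_f.
  move=> arrowE; have fg : f \in face g.
    by have := sub g; rewrite arrowE porbit_id /face /cell orbit_sym => ->.
  case: (I3P j) => ->.
  - by rewrite face_r ?in01 // arrowE face_porbit // addbT.
  - rewrite face_r ?in01 // arrowE addbT -face_porbit //.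
    by rewrite -(porbit_rot (r_ 0 f)) rotE rK.
  by rewrite -coherent !inE addbF.
(* The arrow of a face is the orbit of any of its flags of color [true]. *)
pose arrow (F : {set flag M}) :=
  if [pick g in F | a g] is Some g then porbit rot g else set0.
have arrowP f : exists g,
    [/\ g \in face f, a g & arrow (face f) = porbit rot g].
  rewrite /arrow; case: pickP => [g /andP[gf ag]|none]; first by exists g.
  have := none f; have := none (r_ 0 f).
  by rewrite face_refl face_step ?in01 ?face_refl //= aP in01; case: (a f).
have a_rot f g : f \in porbit rot g -> a f = a g.
  move=> /porbitP[n ->]; elim: n => [|n IHn]; first by rewrite expg0 perm1.
  by rewrite expgSr permM rotE !aP !in01 !addbT negbK.
have arrow_a f : (f \in arrow (face f)) = a f.
  have [g [gf ag ->]] := arrowP f.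
  have [/a_rot-> // | fNg] := boolP (f \in porbit rot g).
  have fg : f \in face g by rewrite /face /cell orbit_sym.
  move: fNg; rewrite -face_porbit // => /a_rot.
  by rewrite aP in01 addbT ag; case: (a f).
exists arrow; split=> [F /imsetP[f _ ->] | f]; last first.
  by rewrite !arrow_a aP !inE addbF.
have [g [gf _ ->]] := arrowP f; split; first exact: imset_f.
apply/subsetP=> h /porbitP[n ->]; elim: n => [|n IHn].
  by rewrite expg0 perm1.
by rewrite expgSr permM rotE; do !apply: face_step; rewrite ?in01.
Qed.

End Faces.

(** * Colorings of [X(M,I)] *)

Lemma third_uniq (i j k : 'I_3) : uniq [:: i; j; k] -> third i j = k.
Proof.
by case: (I3P i) => ->; case: (I3P j) => ->; case: (I3P k) => -> // _;
  rewrite thirdE.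
Qed.

Lemma thirdC (i e : 'I_3) : third i e = third e i.
Proof. by rewrite /third addrC. Qed.

Lemma thirdK i : involutive (third i).
Proof. by move=> e; rewrite /third opprD opprK addKr. Qed.

Lemma third_neq (i e : 'I_3) : e != i -> third i e != i.
Proof. by case: (I3P i) => ->; case: (I3P e) => ->. Qed.

Section XColor.
Variables (M : surface_map) (I : {set 'I_3}).
Local Notation triple := (flag M * 'I_3 * 'I_3)%type.

(** The direction, with respect to the cyclic order of the labels 0, 1, 2 of the
    corners of a triangle, in which its side [x.1.2] is traversed from its end
    [x.2]. *)
Definition flag_sign (x : triple) : bool := x.2 == x.1.2 + 1.

Lemma Xraw01_cases k (x : triple) : k \in [set 0; 1] -> Xvalid I x ->
  let y := Xraw I k x in
  (y.1.1 = x.1.1 /\ flag_sign y = ~~ flag_sign x) \/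
  (exists2 j, j \notin I & y.1.1 = r_ j x.1.1 /\ flag_sign y = flag_sign x).
Proof.
have swap_sign (i e : 'I_3) : e != i ->
    ((third i e == i + 1) = ~~ (e == i + 1)) *
    ((e == third i e + 1) = ~~ (e == i + 1)).
  by case: (I3P i) => ->; case: (I3P e) => ->.
case: x => [[f i] e]; rewrite !inE => /orP[]/eqP-> /and3P[iI ei _] /=.
  rewrite /Xraw /X0 /=; case: ifPn => [/andP[_ eI] | _].
    by right; exists e.
  by left; rewrite /flag_sign /= swap_sign.
rewrite /Xraw /X1 /=; case: ifPn => [_ | eI].
  by left; rewrite /flag_sign /= swap_sign.
by right; exists (third i e).
Qed.

Lemma Xraw2_base (x : triple) : (Xraw I 2 x).1.1 = r_ x.1.2 x.1.1.
Proof. by case: x => [[f i] e]. Qed.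

Lemma Xraw2_sign (x : triple) : flag_sign (Xraw I 2 x) = flag_sign x.
Proof. by case: x => [[f i] e]. Qed.

Lemma Xvalid_side (x : triple) : Xvalid I x -> x.1.2 \in I.
Proof. by case: x => [[f i] e] /and3P[]. Qed.

(** The value [b + flag_sign] depends only on the underlying flag of [M].
    Two distinct flags of [X(M,I)] on the same side of a flag of [M] are
    exchanged by [r_0]; two distinct sides in [I] have a common end, at which
    they are exchanged by [r_1].  These moves stay over the same flag of [M] and
    reverse the sign. *)
Lemma X_color_same_base (b : triple -> bool) :
    (forall k x, k \in [set 0; 1] -> Xvalid I x -> b (Xraw I k x) = ~~ b x) ->
  forall x y, Xvalid I x -> Xvalid I y -> x.1.1 = y.1.1 ->
  b x (+) flag_sign x = b y (+) flag_sign y.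
Proof.
move=> bP [[f i] e] [[g i'] e'] vx vy /= E; subst g.
pose c x := b x (+) flag_sign x; rewrite -/(c (f, i, e)) -/(c (f, i', e')).
have cP k x : k \in [set 0; 1] -> Xvalid I x ->
    (Xraw I k x).1.1 = x.1.1 -> c (Xraw I k x) = c x.
  move=> k01 v Ebase; rewrite /c bP //.
  case: (Xraw01_cases k01 v) => [[_ ->] | [j _ [Ej _]]].
    by rewrite addbN addNb negbK.
  by have := r_fpfree j x.1.1; rewrite -Ej Ebase eqxx.
have same_side i1 e1 e2 : Xvalid I (f, i1, e1) -> Xvalid I (f, i1, e2) ->
    c (f, i1, e1) = c (f, i1, e2).
  move=> v1 v2; have [-> // | e12] := eqVneq e1 e2.
  have [/and3P[_ e1i _] /and3P[_ e2i e2I]] := (v1, v2).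
  have E12 : third i1 e1 = e2.
    by apply: third_uniq; rewrite /= !inE negb_or !(eq_sym i1) e1i e2i e12.
  have E0 : Xraw I 0 (f, i1, e1) = (f, i1, e2).
    rewrite /Xraw /X0 /= E12; case: ifP => // /andP[e2_1].
    by have := implyP e2I e2_1; rewrite -E12 thirdK => ->.
  by rewrite -E0 cP ?E0 ?in01.
have [Ei | ii'] := eqVneq i i'.
  by rewrite -Ei in vy *; apply: same_side.
have [/and3P[iI _ _] /and3P[i'I _ _]] := (vx, vy).
pose e1 := third i i'; have Ei : third i e1 = i' by rewrite /e1 thirdK.
have Ei' : third i' e1 = i by rewrite /e1 (thirdC i) thirdK.
have v : Xvalid I (f, i, e1).
  by rewrite /= iI Ei i'I implybT third_neq // eq_sym.
have v' : Xvalid I (f, i', e1).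
  rewrite /= i'I Ei' iI implybT /e1 thirdC.
  by rewrite third_neq.
have E1 : Xraw I 1 (f, i, e1) = (f, i', e1) by rewrite /Xraw /X1 /= Ei i'I.
by rewrite (same_side _ _ _ vx v) (same_side _ _ _ vy v') -E1 cP ?E1 ?in01.
Qed.

Hypothesis I_neq0 : I != set0.

Lemma X_colorable :
  colorable (X M I_neq0) [set 0; 1] <-> colorable M (~: I).
Proof.
split=> /colorableP[c cP]; apply/colorableP; last first.
  exists (fun x => c (val x).1.1 (+) flag_sign (val x)) => x k.
  rewrite val_Xr.
  have [k01 | kN01] := boolP (k \in [set 0; 1]).
    have := Xraw01_cases k01 (valP x).
    move=> [[-> ->] | [j jI [-> ->]]]; first by rewrite addbN addbT.
    by rewrite cP inE jI !addbT addNb.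
  have -> : k = 2 by move: kN01; rewrite !inE; case: (I3P k) => ->.
  by rewrite Xraw2_base Xraw2_sign cP inE Xvalid_side ?(valP x) // !addbF.
(* [b] extends the coloring [c] to invalid triples by an irrelevant value. *)
pose b (x : triple) := if insub x is Some y then c (y : flag (X M I_neq0))
                       else false.
have b_val (x : flag (X M I_neq0)) : b (val x) = c x by rewrite /b valK.
have bP k x : Xvalid I x -> b (Xraw I k x) = b x (+) (k \in [set 0; 1]).
  move=> v; pose y : flag (X M I_neq0) := Sub x v.
  have E : val y = x by [].
  by rewrite -E -val_Xr !b_val; apply: cP.
have b01 k x : k \in [set 0; 1] -> Xvalid I x -> b (Xraw I k x) = ~~ b x.
  by move=> k01 v; rewrite bP // k01 addbT.
have same_base := X_color_same_base b01.
pose d x := b x (+) flag_sign x.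
have ex f : exists x : flag (X M I_neq0), (val x).1.1 == f.
  by have [x <-] := Xflag_inhab I_neq0 f; exists x.
exists (fun f => d (val (xchoose (ex f)))) => f j.
have dE x : Xvalid I x -> d (val (xchoose (ex x.1.1))) = d x.
  move=> v; apply: same_base v _; first exact: valP.
  exact/eqP/(xchooseP (ex x.1.1)).
rewrite inE; have [jI | jI] := boolP (j \in I).
  have [x [<- <-]] := Xstep_in f jI.
  rewrite val_Xr !dE ?Xraw_valid ?(valP x) // /d Xraw2_sign bP ?(valP x) //.
  by rewrite !inE !addbF.
have [x [k [k01 <- Ej]]] := Xstep_notin I_neq0 f jI.
rewrite -Ej val_Xr !dE ?Xraw_valid ?(valP x) // /d b01 ?(valP x) //.
case: (Xraw01_cases k01 (valP x)) => [[E _] | [_ _ [_ ->]]].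
  by move: Ej; rewrite val_Xr E => /esym/eqP; rewrite (negPf (r_fpfree _ _)).
by rewrite addNb addbT.
Qed.

End XColor.

(** * Orientability *)

(** The elements of order 3 of the symmetric group on [{0,1,2}] are the two
    rotations. *)
Lemma perm3_order3 (p : {perm 'I_3}) :
  #[p]%g = 3 -> forall i, p i = if p 0 == 1 then i + 1 else i - 1.
Proof.
move=> p3.
have ppp i : p (p (p i)) = i.
  have /permP/(_ i) := expg_order p.
  by rewrite p3 !expgS expg0 !permM perm1 perm1.
have [i pi] : exists i, p i != i.
  apply/existsP; apply: contraPT p3; rewrite negb_exists => /forallP fix_p.
  suff -> : p = 1%g by rewrite order1.
  by apply/permP=> i; rewrite perm1; apply/eqP; rewrite -[_ == _]negbK.
move: (introT eqP (ppp 0)) (introT eqP (ppp 1)) (introT eqP (ppp 2)).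
case: (I3P (p 0)) => E0; case: (I3P (p 1)) => E1; case: (I3P (p 2)) => E2;
rewrite ?(E0, E1, E2) // => _ _ _ j.
(* Only the identity and the two rotations have a trivial cube. *)
- by case: (I3P i) pi => ->; rewrite ?(E0, E1, E2) eqxx.
- by apply/eqP; case: (I3P j) => ->; rewrite ?(E0, E1, E2).
- by apply/eqP; case: (I3P j) => ->; rewrite ?(E0, E1, E2).
Qed.

(** The rotation [i |-> i + 1] of the corners of a triangle. *)
Definition corner_rot : {perm 'I_3} := perm (addrI (1 : 'I_3)).

Lemma corner_rotE i : corner_rot i = 1 + i.
Proof. by rewrite permE. Qed.

Lemma corner_rotVE i : (corner_rot^-1)%g i = i - 1.
Proof.
by apply: (@perm_inj _ corner_rot); rewrite permKV corner_rotE addrC subrK.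
Qed.

Lemma corner_rot_order : #[corner_rot]%g = 3.
Proof.
apply: nt_prime_order => //.
  apply/permP=> i; rewrite !expgS expg0 !permM !corner_rotE !perm1.
  by case: (I3P i) => ->; apply/val_inj.
by apply/eqP=> /permP/(_ 0); rewrite corner_rotE perm1 => /eqP.
Qed.

Lemma orientableP (M : surface_map) : orientable M <-> colorable M setT.
Proof.
split=> [[o [o3 coherent]] | /colorableP[a aP]].
  apply/colorableP; exists (fun f => o f 0 == 1) => f i; rewrite inE addbT.
  (* A single side condition, in one direction of the side [i], suffices. *)
  have := coherent f i (i + 1) (i + 2).
  rewrite (perm3_order3 (o3 f) (i + 1)) (perm3_order3 (o3 (r_ i f)) (i + 2)).
  move: (o f 0 == 1) (o (r_ i f) 0 == 1) => x y {coherent}.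
  by case: (I3P i) => -> /(_ isT); case: x; case: y.
exists (fun f => if a f then corner_rot else corner_rot^-1)%g.
split=> [f | f i j k].
  by case: ifP; rewrite ?orderV corner_rot_order.
rewrite aP inE addbT.
by case: (a f); rewrite /= !(corner_rotE, corner_rotVE);
  case: (I3P i) => ->; case: (I3P j) => ->; case: (I3P k) => ->.
Qed.

Theorem theorem5p4 (M : surface_map) (I : {set 'I_3}) :
  pseudo_orientable M I <-> colorable M (~: I).
Proof.
have [-> | I_neq0] := eqVneq I set0.
  rewrite setC0; apply: (iff_trans _ (orientableP M)).
  split=> [[orient _] | orient]; first exact: orient.
  by split=> // I_neq0; case/eqP: (I_neq0).
apply: (iff_trans _ (X_colorable M I_neq0)).
apply: (iff_trans _ (face_pseudo_orientableP _)).
split=> [[_ pseudo] | pseudo]; first exact: pseudo.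
split=> [I0 | I_neq0']; first by case/eqP: (I_neq0).
by rewrite (bool_irrelevance I_neq0' I_neq0).
Qed.
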